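(* Let $G$ be a connected finite simple graph with a perfect matching and $2n\geq 4$ vertices. Then $$-\tfrac{1}{2}(n^2-n-2)\leq gf(G)-Af(G)\leq (n-1)(n-2),$$ and the left-hand equality holds if and only if $n=2$.
   Context: For a perfect matching $M$ of $G$, $af(G,M)$ is the minimum size of a subset $S\subseteq E(G)\setminus M$ such that $G-S$ (delete the edges of $S$) has a unique perfect matching, and $Af(G)=\max_M af(G,M)$ over all perfect matchings. $gf(G)$ is the minimum size of an edge subset $S$ such that no two distinct perfect matchings $M_1,M_2$ of $G$ satisfy $M_1\cap S=M_2\cap S$. *)

(* Defs.v *)
From mathcomp Require Import all_boot.

Set Implicit Arguments.
Unset Strict Implicit.
Unset Printing Implicit Defensive.

(* A finite simple graph on the vertex set T is an adjacency relation e : rel T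
   that is symmetric and irreflexive; an edge is the two-element set of its
   endpoints. *)

Section PerfectMatchings.

Variables (T : finType) (e : rel T).

Definition edges : {set {set T}} :=
  [set [set p.1; p.2] | p in [set p : T * T | e p.1 p.2]].

Definition perfect_matching (M : {set {set T}}) : bool :=
  (M \subset edges) && [forall v, #|[set f in M | v \in f]| == 1].

Definition perfect_matchings : {set {set {set T}}} :=
  [set M | perfect_matching M].

End PerfectMatchings.

Definition delete_edges (T : finType) (e : rel T) (S : {set {set T}}) : rel T :=
  [rel x y | e x y && ([set x; y] \notin S)].

Section Forcing.

Variables (T : finType) (e : rel T).

Definition anti_forcing_set (M S : {set {set T}}) : bool :=
  (S \subset edges e :\: M) && (#|perfect_matchings (delete_edges e S)| == 1).

(* When M is a perfect matching, [edges e :\: M] is an anti-forcing set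
   (lemma [anti_forcing_setD]), so the minimum is attained. *)
Definition anti_forcing_number (M : {set {set T}}) : nat :=
  #|[arg min_(S < edges e :\: M | anti_forcing_set M S) #|S|]|.

Definition max_anti_forcing_number : nat :=
  \max_(M in perfect_matchings e) anti_forcing_number M.

Definition global_forcing_set (S : {set {set T}}) : bool :=
  (S \subset edges e) &&
  [forall M1 in perfect_matchings e, forall M2 in perfect_matchings e,
     (M1 != M2) ==> (M1 :&: S != M2 :&: S)].

(* [edges e] is always a global forcing set (lemma [global_forcing_setT]). *)
Definition global_forcing_number : nat :=
  #|[arg min_(S < edges e | global_forcing_set S) #|S|]|.

Lemma global_forcing_setT : global_forcing_set (edges e).
Proof.
rewrite /global_forcing_set subxx /=.
apply/forall_inP => M1; rewrite inE => /andP[/setIidPl s1 _].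
apply/forall_inP => M2; rewrite inE => /andP[/setIidPl s2 _].
by rewrite s1 s2; apply/implyP.
Qed.

Lemma edges_delete S : edges (delete_edges e S) = edges e :\: S.
Proof.
apply/setP => f; rewrite inE; apply/imsetP/andP => [[p]|[fS /imsetP[p]]].
  rewrite inE /= => /andP[ep pS] ->; split=> //.
  by apply/imsetP; exists p; rewrite ?inE.
rewrite inE => ep fE; exists p => //.
by rewrite inE; apply/andP; rewrite -fE.
Qed.

Lemma anti_forcing_setD (M : {set {set T}}) :
  M \in perfect_matchings e -> anti_forcing_set M (edges e :\: M).
Proof.
rewrite inE => /andP[sM /forallP pM].
rewrite /anti_forcing_set subxx /=; apply/cards1P; exists M.
apply/setP => N; rewrite !inE /perfect_matching edges_delete.
rewrite setDDr setDv set0U (setIidPr sM).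
apply/andP/eqP => [[sN /forallP pN]|->]; last by split=> //; apply/forallP.
apply/eqP; rewrite eqEsubset sN /=; apply/subsetP => f fM.
have /imsetP[p _ fE] := subsetP sM f fM.
have pf : p.1 \in f by rewrite fE set21.
have /cards1P[g gE] := pN p.1; have /cards1P[h hE] := pM p.1.
have : g \in [set f in N | p.1 \in f] by rewrite gE set11.
rewrite inE => /andP[gN pg].
have : g \in [set f in M | p.1 \in f] by rewrite inE (subsetP sN) ?pg.
have : f \in [set f in M | p.1 \in f] by rewrite inE fM.
by rewrite hE !inE => /eqP -> /eqP <-.
Qed.

End Forcing.

(* Main.v *)
(* Perfect matchings are encoded as fixed-point-free involutions s with
   e x (s x) for all x. Let |V| = 2n and m = |E|.

   Upper bound. Fix a perfect matching u and a minimum anti-forcing set A, and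
   let H = G - A, so that af(G,u) = m - |E(H)|. Two edges of u span at most two
   further edges of H, since a third one would close a u-alternating 4-cycle;
   two such edges form a triangle with an edge of u. Hanging such triangles
   below one another as long as possible leaves c root edges of u that pairwise
   span at most one edge of H, whence |E(H)| <= n^2 - c(c-1)/2. The n - c
   triangles extend to a connected spanning cactus F of G with 3n - 1 - c edges,
   all of whose cycles are triangles. By parity, two perfect matchings cannot
   differ only inside F, so gf(G) <= m - |F|.

   Lower bound. Take u with af(G,u) = Af(G), a minimum global forcing set S, and
   a bipartition X, Y of V transversal to u. In the bipartite graph between X
   and Y some x in X has at most one edge outside S: otherwise walk from x along
   an edge outside both S and a perfect matching M, then along M; switching M on
   the cycle so produced contradicts either the choice of M (meeting S as little
   as possible) or the fact that S separates perfect matchings. Deleting the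
   edges at x outside u, removing x and u x, and iterating, one gets
   af(G,u) <= e(Y) + |S n E(X,Y)|. A nonedge inside Y or an edge of S inside
   X or Y improves the resulting bound gf + n(n-1)/2 by one; one such gain is
   always available, and two are when n >= 3. *)
Require Import Defs.
From mathcomp Require Import all_boot all_fingroup all_order all_algebra.
From mathcomp Require Import zify lra.

Set Implicit Arguments.
Unset Strict Implicit.
Unset Printing Implicit Defensive.

(** * Perfect matchings as involutions *)

Section Mates.

Variables (T : finType) (e : rel T).
Hypotheses (e_sym : symmetric e) (e_irr : irreflexive e).

Definition mates (d : rel T) (s : T -> T) := involutive s /\ forall x, d x (s x).

Definition mate_edges (s : T -> T) : {set {set T}} := [set [set x; s x] | x : T].

Lemma set2_eq_involutive (s : T -> T) (x y z : T) :
  involutive s -> [set x; y] = [set z; s z] -> y = s x.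
Proof.
move=> sK E.
have : x \in [set z; s z] by rewrite -E set21.
have : y \in [set z; s z] by rewrite -E set22.
have : z \in [set x; y] by rewrite E set21.
have : s z \in [set x; y] by rewrite E set22.
rewrite !inE => sz zx /orP[]/eqP yE /orP[]/eqP xE; subst x y; rewrite ?sK //.
- by move: sz; rewrite orbb => /eqP.
- by move: zx; rewrite orbb => /eqP {1}->; rewrite sK.
Qed.

Lemma mem_mate_edges (s : T -> T) (x y : T) :
  involutive s -> ([set x; y] \in mate_edges s) = (y == s x).
Proof.
move=> sK; apply/imsetP/eqP => [[z _ /(set2_eq_involutive sK)] //|->].
by exists x.
Qed.

Lemma mem_edges (x y : T) : ([set x; y] \in edges e) = e x y.
Proof.
apply/imsetP/idP => [[[a b]]|exy]; last by exists (x, y); rewrite ?inE.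
rewrite inE /= => eab /setP E.
have ab : a != b by apply: contraTneq eab => ->; rewrite e_irr.
move: (E x) (E y) (E a) (E b); rewrite !inE !eqxx /= !orbT.
move=> /esym/orP[]/eqP -> /esym/orP[]/eqP -> //.
- by rewrite ![b == _]eq_sym orbb (negPf ab).
- by rewrite e_sym.
- by rewrite orbb (negPf ab).
Qed.

Lemma edgesP (f : {set T}) :
  reflect (exists x y, e x y /\ f = [set x; y]) (f \in edges e).
Proof.
apply: (iffP imsetP) => [[[x y]]|[x [y [exy ->]]]].
  by rewrite inE => exy ->; exists x, y.
by exists (x, y); rewrite ?inE.
Qed.

Lemma mates_neq (s : T -> T) (x : T) : mates e s -> s x != x.
Proof. by case=> _ /(_ x); apply: contraTneq => ->; rewrite e_irr. Qed.

Lemma mates_perfect_matching (s : T -> T) :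
  mates e s -> perfect_matching e (mate_edges s).
Proof.
move=> [sK es]; apply/andP; split.
  by apply/subsetP => f /imsetP[x _ ->]; rewrite mem_edges.
apply/forallP => v; apply/cards1P; exists [set v; s v].
apply/setP => f; rewrite !inE; apply/andP/eqP => [[/imsetP[x _ ->]]|->].
  by rewrite !inE => /orP[]/eqP ->; rewrite // sK setUC.
by rewrite mem_mate_edges // eqxx set21.
Qed.

Lemma perfect_matchingP (M : {set {set T}}) :
  perfect_matching e M -> exists2 s, mates e s & M = mate_edges s.
Proof.
move=> /andP[/subsetP sM /forallP pM].
(* The default [v] is never taken: [sP] shows that the pick always succeeds. *)
pose s v := odflt v [pick w | [set v; w] \in M].
have sP v : [set v; s v] \in M.
  rewrite /s; case: pickP => //= no; have /cards1P[f /setP/(_ f)] := pM v.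
  rewrite !inE eqxx => /andP[fM vf].
  have /edgesP[x [y [_ fE]]] := sM f fM.
  move: vf; rewrite fE !inE => /orP[]/eqP vE.
    by have := no y; rewrite vE -fE fM.
  by have := no x; rewrite vE setUC -fE fM.
have es v : e v (s v) by rewrite -mem_edges sM.
have Muniq f g v : f \in M -> g \in M -> v \in f -> v \in g -> f = g.
  move=> fM gM vf vg; have /cards1P[h hE] := pM v.
  have : f \in [set f in M | v \in f] by rewrite inE fM.
  have : g \in [set f in M | v \in f] by rewrite inE gM.
  by rewrite hE !inE => /eqP -> /eqP ->.
have sK : involutive s.
  move=> v; have E := Muniq _ _ (s v) (sP v) (sP (s v)) (set22 _ _) (set21 _ _).
  have : s (s v) \in [set v; s v] by rewrite E set22.
  rewrite !inE => /orP[]/eqP // sE.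
  by have := es (s v); rewrite sE e_irr.
exists s => //; apply/setP => f; apply/idP/imsetP => [fM|[x _ ->]] //.
have /edgesP[x [y [_ fE]]] := sM f fM; exists x => //.
by apply: (Muniq _ _ x fM (sP x)); rewrite ?fE !inE eqxx.
Qed.

Lemma eq_mate_edges (s t : T -> T) :
  involutive s -> mate_edges t = mate_edges s -> t =1 s.
Proof.
move=> sK E x; apply/eqP; rewrite -mem_mate_edges // -E.
by apply/imsetP; exists x.
Qed.

(** The global forcing condition read vertex by vertex: two matchings have the same trace on [S]
    when, wherever their mates differ, both edges avoid [S]. Here [S] may be any set of vertex sets,
    as complements of edge sets also occur. *)
Definition separates (S : {set {set T}}) := forall s t, mates e s -> mates e t ->
  (forall x, s x != t x -> [set x; s x] \notin S /\ [set x; t x] \notin S) ->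
  s =1 t.

Lemma global_forcing_setP (S : {set {set T}}) :
  reflect (S \subset edges e /\ separates S) (global_forcing_set e S).
Proof.
apply: (iffP andP) => -[sS].
  move=> /forall_inP H; split=> // s t es et st.
  have [sK _] := es; have [tK _] := et.
  apply: eq_mate_edges => //; apply/eqP.
  have ps : mate_edges s \in perfect_matchings e.
    by rewrite inE mates_perfect_matching.
  have pt : mate_edges t \in perfect_matchings e.
    by rewrite inE mates_perfect_matching.
  have /forall_inP/(_ _ pt)/implyP := H _ ps.
  move=> H1; apply: contraT => neq.
  have /eqP[] := H1 neq; apply/setP => f; rewrite !inE.
  have [fS|_] := boolP (f \in S); last by rewrite !andbF.
  rewrite !andbT; have /edgesP[x [y [_ fE]]] := subsetP sS f fS.
  rewrite fE (mem_mate_edges _ _ sK) (mem_mate_edges _ _ tK).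
  have [<- //|/st] := eqVneq (s x) (t x).
  rewrite fE in fS; case=> sS' tS'; rewrite !(negbTE (contraTneq _ fS)) //.
    by move=> ->.
  by move=> ->.
move=> sep; split=> //; apply/forall_inP => M; rewrite inE => pM.
apply/forall_inP => N; rewrite inE => pN; apply/implyP; apply: contraNneq => E.
have [s es ME] := perfect_matchingP pM; have [t et NE] := perfect_matchingP pN.
rewrite ME NE; apply/eqP; apply: eq_imset => x; congr [set _; _].
have [sK _] := es; have [tK _] := et.
apply: sep => // z nst; split; apply/negP => zS.
  have : [set z; s z] \in M :&: S by rewrite inE zS ME mem_mate_edges // eqxx.
  by rewrite E inE NE mem_mate_edges // (negPf nst).
have : [set z; t z] \in N :&: S by rewrite inE zS NE mem_mate_edges // eqxx.
by rewrite -E inE ME mem_mate_edges // eq_sym (negPf nst).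
Qed.

End Mates.

(** * Anti-forcing and global forcing numbers; switching on 4-cycles *)

Section AntiForcing.

Variables (T : finType) (e : rel T).
Hypotheses (e_sym : symmetric e) (e_irr : irreflexive e).

Lemma delete_edges_sym A : symmetric (delete_edges e A).
Proof. by move=> x y; rewrite /delete_edges /= e_sym setUC. Qed.

Lemma delete_edges_irr A : irreflexive (delete_edges e A).
Proof. by move=> x; rewrite /delete_edges /= e_irr. Qed.

Lemma mates_delete_edges A s :
  mates (delete_edges e A) s <->
  mates e s /\ forall x, [set x; s x] \notin A.
Proof.
split=> [[sK H]|[[sK es] sA]].
  by split; [split|] => // x; have /andP[] := H x.
by split=> // x; rewrite /delete_edges /= es sA.
Qed.

(** Since [A] avoids the edges of [u], the matching [u] survives the deletion; a unique perfect
    matching must therefore be [u]. *)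
Lemma anti_forcing_setP (u : T -> T) (A : {set {set T}}) : mates e u ->
  reflect (A \subset edges e :\: mate_edges u /\
           forall s, mates e s -> (forall x, [set x; s x] \notin A) -> s =1 u)
          (anti_forcing_set e (mate_edges u) A).
Proof.
move=> eu; have [uK _] := eu.
apply: (iffP andP) => -[sA H]; split=> //.
  move=> s es sA'; have /cards1P[N NE] := H.
  have uA x : [set x; u x] \notin A.
    apply: contraTN isT => /(subsetP sA); rewrite inE mem_mate_edges //.
    by rewrite eqxx.
  have pmN t : mates e t -> (forall x, [set x; t x] \notin A) ->
      mate_edges t = N.
    move=> et tA; apply/eqP; rewrite -in_set1 -NE inE.
    apply: mates_perfect_matching; first exact: delete_edges_sym.
      exact: delete_edges_irr.
    exact/mates_delete_edges.
  by apply: eq_mate_edges => //; rewrite !pmN.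
apply/cards1P; exists (mate_edges u); apply/setP => N; rewrite !inE.
apply/idP/eqP => [|->].
  case/(perfect_matchingP (@delete_edges_sym A) (@delete_edges_irr A)).
  move=> s /mates_delete_edges[es sA'] ->.
  by apply: eq_imset => x; rewrite H.
apply: mates_perfect_matching; first exact: delete_edges_sym.
  exact: delete_edges_irr.
apply/mates_delete_edges; split=> // x.
apply: contraTN isT => /(subsetP sA); rewrite inE mem_mate_edges //.
by rewrite eqxx.
Qed.

Lemma anti_forcing_number_le (u : T -> T) (A : {set {set T}}) :
  mates e u -> anti_forcing_set e (mate_edges u) A ->
  anti_forcing_number e (mate_edges u) <= #|A|.
Proof.
move=> eu hA; rewrite /anti_forcing_number; case: arg_minnP => [|B _]; last exact.
by apply: anti_forcing_setD; rewrite inE mates_perfect_matching.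
Qed.

Lemma anti_forcing_number_attained (u : T -> T) : mates e u ->
  exists2 A, anti_forcing_set e (mate_edges u) A
           & #|A| = anti_forcing_number e (mate_edges u).
Proof.
move=> eu; rewrite /anti_forcing_number; case: arg_minnP => [|B hB _].
  by apply: anti_forcing_setD; rewrite inE mates_perfect_matching.
by exists B.
Qed.

Lemma anti_forcing_number_le_max (u : T -> T) : mates e u ->
  anti_forcing_number e (mate_edges u) <= max_anti_forcing_number e.
Proof.
move=> eu; rewrite /max_anti_forcing_number.
by apply: leq_bigmax_cond; rewrite inE mates_perfect_matching.
Qed.

Lemma max_anti_forcing_number_attained :
  (exists M, perfect_matching e M) ->
  exists2 u, mates e u
    & max_anti_forcing_number e = anti_forcing_number e (mate_edges u).
Proof.
move=> [M0 pM0]; rewrite /max_anti_forcing_number.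
have : 0 < #|perfect_matchings e| by apply/card_gt0P; exists M0; rewrite inE.
case/(eq_bigmax_cond (anti_forcing_number e)) => M + ->; rewrite inE => pM.
by have [u eu ->] := perfect_matchingP e_sym e_irr pM; exists u.
Qed.

Lemma global_forcing_number_le S :
  global_forcing_set e S -> global_forcing_number e <= #|S|.
Proof.
move=> hS; rewrite /global_forcing_number; case: arg_minnP => [|B _]; last exact.
exact: global_forcing_setT.
Qed.

Lemma global_forcing_number_attained :
  exists2 S, global_forcing_set e S & #|S| = global_forcing_number e.
Proof.
rewrite /global_forcing_number; case: arg_minnP => [|B hB _].
  exact: global_forcing_setT.
by exists B.
Qed.

(** As a conjugate of [s] by a transposition this is again an involution. It trades the pairs [x],
    [s x] and [y], [s y] for [x], [y] and [s x], [s y]. *)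
Definition switch (s : T -> T) (x y : T) : T -> T :=
  fun z => tperm (s x) y (s (tperm (s x) y z)).

Lemma switchL s x y : involutive s -> s x != x -> y != x -> switch s x y x = y.
Proof. by move=> sK sx yx; rewrite /switch (tpermD sx yx) tpermL. Qed.

Lemma switchR s x y : involutive s -> s x != x -> y != x -> switch s x y y = x.
Proof. by move=> sK sx yx; rewrite /switch tpermR sK (tpermD sx yx). Qed.

Lemma switch_id s x y z : involutive s ->
  z != x -> z != y -> z != s x -> z != s y -> switch s x y z = s z.
Proof.
move=> sK zx zy zsx zsy.
rewrite /switch (tpermD _ _ : tperm (s x) y z = z) 1?eq_sym //.
by rewrite tpermD // eq_sym ?(inj_eq (inv_inj sK)) // (can2_eq sK sK).
Qed.

Lemma mates_switch d s x y : symmetric d -> irreflexive d -> mates d s ->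
  y != x -> d x y -> d (s x) (s y) -> mates d (switch s x y).
Proof.
move=> d_sym d_irr ds yx dxy dsxy; have [sK dss] := ds.
have sn z : s z != z by apply: mates_neq ds.
have tK : involutive (switch s x y).
  by move=> z; rewrite /switch tpermK sK tpermK.
split=> // z.
have dR w : d w (switch s x y w) -> d (switch s x y w) (switch s x y (switch s x y w)).
  by rewrite tK d_sym.
have dx : d x (switch s x y x) by rewrite switchL.
have dsx : d (s x) (switch s x y (s x)).
  rewrite /switch tpermL; have [->|syx] := eqVneq (s x) y.
    by rewrite tperm1 perm1 dss.
  rewrite tpermD //; last by rewrite eq_sym.
  by rewrite (inj_eq (inv_inj sK)) eq_sym.
have [->//|zx] := eqVneq z x.
have [->|zy] := eqVneq z y; first by rewrite switchR // d_sym.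
have [->//|zsx] := eqVneq z (s x).
have [zsy|zsy] := eqVneq z (s y); last by rewrite switch_id.
have [syx|syx] := eqVneq y (s x); first by move: zx; rewrite zsy syx sK eqxx.
have E : switch s x y (s x) = s y.
  rewrite /switch tpermL tpermD ?(inj_eq (inv_inj sK)) 1?eq_sym //.
by rewrite zsy -E dR.
Qed.

End AntiForcing.

(** * Cacti built from edges and triangles *)

Section Cactus.

Variables (T : finType) (e : rel T).
Hypotheses (e_sym : symmetric e) (e_irr : irreflexive e).

Lemma even_card_involution (s : T -> T) (W : {set T}) :
  involutive s -> (forall x, s x != x) -> (forall x, x \in W -> s x \in W) ->
  odd #|W| = false.
Proof.
move=> sK sn; have [m] := ubnP #|W|; elim: m W => // m IH W ltW sW.
have [->|[x xW]] := set_0Vmem W; first by rewrite cards0.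
have sx := sW _ xW; have xsx : s x \in W :\ x by rewrite !inE sn.
have := cardsD1 x W; have := cardsD1 (s x) (W :\ x); rewrite xW xsx => E1 E2.
rewrite E2 E1 /= negbK; apply: IH; first by lia.
move=> y; rewrite !inE => /and3P[ysx yx yW].
by rewrite (inj_eq (inv_inj sK)) yx (can2_eq sK sK) ysx sW.
Qed.

(** For any perfect matching, the number of vertices of [U] matched outside [U] has the parity of
    [#|U|]. All vertices of [U] other than [a] contribute equally to both counts, so [a] does
    too. *)
Lemma mates_cut (s t : T -> T) (U : {set T}) (a : T) :
  mates e s -> mates e t -> a \in U ->
  (forall x, x \in U -> x != a -> (s x \in U) = (t x \in U)) ->
  (s a \in U) = (t a \in U).
Proof.
move=> es et aU H.
have cut r : mates e r -> odd #|[set x in U | r x \notin U]| = odd #|U|.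
  move=> er; have [rK _] := er.
  have even : odd #|U :&: [set x | r x \in U]| = false.
    apply: (@even_card_involution r) => //; first by move=> x; apply: mates_neq er.
    by move=> x; rewrite !inE rK => /andP[-> ->].
  rewrite -(cardsID [set x | r x \in U] U) oddD even /=.
  by congr (odd _); apply: eq_card => x; rewrite !inE andbC.
have := cut s es; rewrite -(cut t et).
rewrite (cardsD1 a) [in RHS](cardsD1 a).
have -> : [set x in U | s x \notin U] :\ a = [set x in U | t x \notin U] :\ a.
  apply/setP => x; rewrite !inE; have [//|xa /=] := eqVneq x a.
  by case: (boolP (x \in U)) => // xU; rewrite H.
rewrite !inE aU /= !oddD !oddb => /addIb; exact: negb_inj.
Qed.

(* The classes of [f] contain the edges of [F], and merging them along an edge
   or along a triangle builds a graph whose blocks are edges and triangles;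
   [k] is the number of vertices plus the number of triangles. *)
Definition cactus (f : T -> T) (F : {set {set T}}) (k : nat) :=
  [/\ F \subset edges e, forall x y, [set x; y] \in F -> f x = f y,
      separates e (~: F) & k <= #|F| + #|f @: T|].

Lemma cactus0 : cactus id set0 #|T|.
Proof.
split; first exact: sub0set.
- by move=> x y; rewrite inE.
- move=> s t _ _ H x; have [//|/H] := eqVneq (s x) (t x).
  by rewrite !inE => -[].
- by rewrite cards0 card_imset //; apply: inj_id.
Qed.

Definition clique_edges (Q : {set T}) : {set {set T}} :=
  [set A : {set T} | A \subset Q & #|A| == 2].

Lemma mem_clique_edges Q x y :
  ([set x; y] \in clique_edges Q) = [&& x != y, x \in Q & y \in Q].
Proof.
rewrite inE cards2 subUset !sub1set andbC.
by case: (x != y).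
Qed.

(** The clique on [Q] adds ['C(#|Q|, 2)] edges and costs [#|Q| - 1] classes, hence the new [k].
    Matchings that differ only inside the enlarged graph agree on the clique edges, so they differ
    only inside [F]. *)
Lemma cactus_join f F k (Q : {set T}) a : cactus f F k ->
  a \in Q -> {in Q &, injective f} -> #|Q| <= 3 ->
  (forall x y, x \in Q -> y \in Q -> x != y -> e x y) ->
  cactus (fun x => if f x \in f @: Q then f a else f x) (F :|: clique_edges Q)
         (k + 'C(#|Q|, 2) + 1 - #|Q|).
Proof.
move=> [sF fF sepF kle] aQ f_inj Q3 Qe.
set N := clique_edges Q; set f' := fun x => _.
have NP A : A \in N -> exists x y, [/\ A = [set x; y], x != y, x \in Q & y \in Q].
  rewrite /N inE => /andP[sA /cards2P[x [y [xy AE]]]].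
  by exists x, y; split; rewrite // (subsetP sA) ?AE ?set21 ?set22.
have fN x y : x != y -> x \in Q -> y \in Q -> f x != f y.
  by move=> xy xQ yQ; apply: contraNneq xy => /f_inj ->.
split.
- rewrite subUset sF; apply/subsetP => A /NP[x [y [-> xy xQ yQ]]].
  by rewrite mem_edges // Qe.
- move=> x y; rewrite in_setU => /orP[/fF|]; first by rewrite /f' => ->.
  by rewrite mem_clique_edges => /and3P[_ xQ yQ]; rewrite /f' !imset_f.
- have key s t : mates e s -> mates e t ->
    (forall x, s x != t x ->
       [set x; s x] \in F :|: N /\ [set x; t x] \in F :|: N) ->
    forall x, x \in Q -> s x \in Q -> t x = s x.
    move=> es et H x xQ sQ; have [sK _] := es; have [tK _] := et.
    (* The class of [q] meets [Q] only in [q]. At its other vertices, edges where [s] and [t] differ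
       lie in [F] and stay in the class, so parity settles the vertex [q]. *)
    have cut q : q \in Q -> (f (s q) == f q) = (f (t q) == f q).
      move=> qQ; pose U := [set x | f x == f q].
      suff : (s q \in U) = (t q \in U) by rewrite !inE.
      apply: mates_cut => //; first by rewrite inE.
      move=> z zU zq; have [-> //|/H[sz tz]] := eqVneq (s z) (t z).
      have inU w : [set z; w] \in F :|: N -> w \in U.
        rewrite in_setU mem_clique_edges => /orP[/fF E|/and3P[_ zQ _]].
          by rewrite inE -E; rewrite inE in zU.
        rewrite inE in zU; have := f_inj _ _ zQ qQ (eqP zU).
        by move=> E; rewrite E eqxx in zq.
      by rewrite !inU.
    have tQ q : q \in Q -> s q \in Q -> s q != t q -> t q \in Q.
      move=> qQ sqQ nst; have [_] := H q nst.
      rewrite in_setU mem_clique_edges => /orP[/fF E|/and3P[] //].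
      have := cut q qQ; rewrite -E eqxx => /eqP /(f_inj _ _ sqQ qQ) sqq.
      by have := mates_neq e_irr q es; rewrite sqq eqxx.
    apply/eqP; rewrite eq_sym; apply: contraT => nst.
    have txQ := tQ _ xQ sQ nst.
    have nst' : s (s x) != t (s x).
      by rewrite sK; apply: contraNneq nst => {2}->; rewrite tK.
    have tsQ : t (s x) \in Q by apply: tQ; rewrite // sK.
    (* A difference at [x] would put four distinct vertices into a clique of at most three. *)
    have : #|[set x; s x; t x; t (s x)]| <= #|Q|.
      apply: subset_leq_card; rewrite !subUset !sub1set.
      by rewrite xQ sQ txQ tsQ.
    have u4 : uniq [:: x; s x; t x; t (s x)].
      rewrite /= !inE !negb_or ![x == _]eq_sym !(mates_neq e_irr) //=.
      rewrite nst -[X in _ == X]sK eq_sym nst' eq_sym (mates_neq e_irr) //.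
      by rewrite (inj_eq (inv_inj tK)) eq_sym (mates_neq e_irr).
    have -> : #|[set x; s x; t x; t (s x)]| = 4.
      transitivity #|[:: x; s x; t x; t (s x)]|; last exact/card_uniqP.
      by apply: eq_card => z; rewrite !inE -!orbA.
    by lia.
  move=> s t es et H; have [sK _] := es; have [tK _] := et.
  have H' x : s x != t x -> [set x; s x] \in F :|: N /\ [set x; t x] \in F :|: N.
    by move=> /H; rewrite !in_setC !negbK.
  have Hs x : t x != s x -> [set x; t x] \in F :|: N /\ [set x; s x] \in F :|: N.
    by rewrite eq_sym => /H'[].
  apply: sepF => // x nst; rewrite !in_setC !negbK.
  have [] := H' x nst; rewrite !in_setU !mem_clique_edges.
  move=> /orP[-> /orP[->|/and3P[_ xQ tQ]]|/and3P[_ xQ sQ]] //.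
    by rewrite (key t s) ?eqxx // in nst.
  by rewrite (key s t) ?eqxx // in nst.
- have cN : #|N| = 'C(#|Q|, 2) by rewrite -cards_draws.
  have FN : F :&: N = set0.
    apply/setP => A; rewrite !in_set0 in_setI; apply/andP => -[AF /NP].
    move=> [x [y [AE xy xQ yQ]]]; have := fN x y xy xQ yQ.
    by rewrite (fF x y) ?eqxx // -AE.
  have cU : #|F :|: N| = #|F| + #|N| by rewrite cardsU FN cards0 subn0.
  have faI : f a \in f' @: T.
    by apply/imsetP; exists a; rewrite // /f' imset_f.
  have sub : f @: T \subset (f' @: T) :\ f a :|: f @: Q.
    apply/subsetP => y /imsetP[x _ ->]; rewrite in_setU in_setD1.
    have [fx|fx] := boolP (f x \in f @: Q); first by rewrite orbT.
    rewrite orbF; apply/andP; split.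
      by apply: contraNneq fx => ->; rewrite imset_f.
    by apply/imsetP; exists x; rewrite // /f' (negPf fx).
  have le1 := subset_leq_card sub.
  have le2 : #|f @: Q| <= #|Q| by apply: leq_imset_card.
  have := cardsD1 (f a) (f' @: T); rewrite faI => E1.
  have := cardsU (f' @: T :\ f a) (f @: Q) => E2.
  rewrite cU cN; lia.
Qed.

End Cactus.

(** * Spanning cacti grown from a perfect matching *)

Section UpperBound.

Variables (T : finType) (e : rel T).
Hypotheses (e_sym : symmetric e) (e_irr : irreflexive e).

(** For a two-element [Q] the change ['C(2, 2) + 1 - 2] of [k] is zero: a bridge between two classes
    trades one class for one edge. *)
Lemma cactus_merge f F k a b : cactus e f F k -> e a b -> f a != f b ->
  exists f' F', cactus e f' F' k /\ #|f' @: T| < #|f @: T|.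
Proof.
move=> cfF eab fab.
have ab : a != b by apply: contraNneq fab => ->.
have cQ : #|[set a; b]| = 2 by rewrite cards2 ab.
have := @cactus_join _ _ e_sym e_irr _ _ _ [set a; b] a cfF (set21 _ _).
rewrite cQ => join; do 2 eexists; split.
  suff -> : k = k + 'C(2, 2) + 1 - 2 by apply: join => // [x y|x y];
    rewrite !inE => /orP[]/eqP-> /orP[]/eqP-> //;
    rewrite ?eqxx ?(e_sym b) // => E; move: fab; rewrite E eqxx.
  by rewrite binn; lia.
apply: (@leq_ltn_trans #|(f @: T) :\ f b|); last first.
  by rewrite [X in _ < X](cardsD1 (f b)) imset_f.
apply: subset_leq_card; apply/subsetP => _ /imsetP[x _ ->].
rewrite in_setD1; case: ifPn => fx; first by rewrite fab imset_f.
by rewrite imset_f // andbT; apply: contraNneq fx => ->; rewrite imset_f ?set22.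
Qed.

(** By connectedness, classes can be merged until at most one is left; the inequality in [cactus]
    then bounds [k] by the number of edges plus one. *)
Lemma cactus_span f F k : (forall x y, connect e x y) -> cactus e f F k ->
  exists F' : {set {set T}}, [/\ F' \subset edges e, separates e (~: F') & k <= #|F'|.+1].
Proof.
move=> e_conn; have [m] := ubnP #|f @: T|; elim: m f F => // m IH f F ltm cfF.
case: (boolP [exists a, exists b, e a b && (f a != f b)]) => [|].
  case/existsP => a /existsP[b /andP[eab fab]].
  have [f' [F' [cf' lt']]] := cactus_merge cfF eab fab.
  by apply: IH cf'; lia.
rewrite negb_exists => /forallP none.
have fe a b : e a b -> f a = f b.
  have := none a; rewrite negb_exists => /forallP/(_ b).
  by rewrite negb_and negbK => /orP[/negPf->|/eqP].
have fconst a b : f a = f b.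
  have /connectP[p pp ->] := e_conn a b.
  by elim: p a pp => //= c p IHp a /andP[/fe-> /IHp].
case: cfF => sF _ sepF kle; exists F; split=> //.
have : #|f @: T| <= 1; last by lia.
by apply/card_le1_eqP => _ _ /imsetP[x _ ->] /imsetP[y _ ->].
Qed.

(** [R] holds the vertices of the root edges, at first all vertices. Hanging a triangle below a root
    vertex takes one edge of [u] out of [R] and raises [k] by one, which keeps [#|R| + 2 * k]
    constant. The process stops when no triangle can be hung. *)
Lemma cactus_forest u : mates e u ->
  exists f F k (R : {set T}),
    [/\ cactus e f F k, #|R| + 2 * k = 3 * #|T|, forall x, x \in R -> u x \in R
      & forall a b, a \in R -> b \in R -> b != a -> b != u a ->
          ~~ (e a b && e a (u b))].
Proof.
move=> eu; have [uK _] := eu.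
suff grow m f F k (R : {set T}) : #|R| < m ->
    cactus e f F k -> #|R| + 2 * k = 3 * #|T| ->
    (forall x, x \in R -> u x \in R) -> {in R &, injective f} ->
  exists f F k (R : {set T}),
    [/\ cactus e f F k, #|R| + 2 * k = 3 * #|T|, forall x, x \in R -> u x \in R
      & forall a b, a \in R -> b \in R -> b != a -> b != u a ->
          ~~ (e a b && e a (u b))].
  apply: (grow _ _ _ _ setT (ltnSn _) (cactus0 e)); rewrite ?cardsT //.
elim: m f F k R => // m IH f F k R ltm cfF kE uR f_inj.
case: (boolP [exists a in R, exists b in R,
         [&& b != a, b != u a, e a b & e a (u b)]]); last first.
  rewrite negb_exists => /forallP none; exists f, F, k, R; split=> // a b aR bR ba bua.
  have := none a; rewrite aR negb_exists => /forallP/(_ b).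
  by rewrite bR ba bua.
case/exists_inP => a aR /exists_inP[b bR /and4P[ba bua eab eaub]].
have ubR := uR _ bR; have ubb : u b != b by apply: mates_neq eu.
have uba : u b != a by rewrite (can2_eq uK uK).
set Q := [set a; b; u b].
have QP x : x \in Q -> [\/ x = a, x = b | x = u b].
  by rewrite !inE -orbA => /or3P[]/eqP->;
    [constructor 1|constructor 2|constructor 3].
have cQ : #|Q| = 3.
  rewrite /Q setUC cardsU1 cards2 !inE negb_or uba ubb eq_sym ba //.
have QR x : x \in Q -> x \in R by case/QP => ->.
have aQ : a \in Q by rewrite !inE eqxx.
have eQ x y : x \in Q -> y \in Q -> x != y -> e x y.
  have [_ ee] := eu; have eb := ee b.
  by case/QP=> -> /QP[]->; rewrite ?eqxx // e_sym.
have := @cactus_join _ _ e_sym e_irr _ _ _ Q a cfF aQ (sub_in2 QR f_inj).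
rewrite cQ => /(_ isT eQ) cfF'.
apply: (IH _ _ _ (R :\ b :\ u b)) cfF' _ _ _.
- have := cardsD1 b R; have := cardsD1 (u b) (R :\ b).
  by rewrite !inE ubb ubR bR /=; lia.
- rewrite -kE; have := cardsD1 b R; have := cardsD1 (u b) (R :\ b).
  by rewrite (_ : 'C(3, 2) = 3) // !inE ubb ubR bR /=; lia.
- move=> x; rewrite !inE => /and3P[xub xb xR].
  by rewrite (inj_eq (inv_inj uK)) xb (can2_eq uK uK) xub uR.
have f'E x : x \in R :\ b :\ u b -> (if f x \in f @: Q then f a else f x) = f x.
  rewrite !inE => /and3P[xub xb xR]; case: ifP => // /imsetP[z zQ fxz].
  have xz := f_inj _ _ xR (QR _ zQ) fxz; move: zQ xub xb; rewrite -xz => /QP[]->;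
    by rewrite ?eqxx.
move=> x y xR yR; rewrite (f'E x xR) (f'E y yR); apply: f_inj.
  by move: xR; rewrite !inE => /and3P[].
by move: yR; rewrite !inE => /and3P[].
Qed.

End UpperBound.

(** * Edges of a graph with a unique perfect matching, and the upper bound *)

Lemma card_edges_le (T : finType) (h : rel T) : symmetric h -> irreflexive h ->
  2 * #|edges h| <= \sum_x \sum_y h x y.
Proof.
move=> h_sym h_irr.
have -> : \sum_x \sum_y h x y = #|[set p : T * T | h p.1 p.2]|.
  rewrite pair_bigA /= -sum1_card [RHS]big_mkcond /=.
  by apply: eq_bigr => p _; rewrite inE; case: (h _ _).
rewrite -[X in _ <= X]sum1_card (partition_big_imset (fun p : T * T => [set p.1; p.2])) /=.
rewrite mulnC -sum_nat_const; apply: leq_sum => f /(edgesP _)[x [y [hxy ->]]].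
have xy : (x, y) != (y, x).
  by apply: contraTneq hxy => -[->]; rewrite h_irr.
rewrite (bigD1 (x, y)) /=; last by rewrite inE hxy eqxx.
by rewrite (bigD1 (y, x)) //= inE h_sym hxy setUC eqxx eq_sym xy.
Qed.

(** Switching [u] on the alternating 4-cycle would give a second perfect matching. *)
Lemma unique_mates_block (T : finType) (h : rel T) (u : T -> T) (x y : T) :
  symmetric h -> irreflexive h -> mates h u ->
  (forall s, mates h s -> s =1 u) -> y != x -> y != u x ->
  ~~ (h x y && h (u x) (u y)).
Proof.
move=> h_sym h_irr hu uniq yx yux; apply/andP => -[hxy huxy].
have := uniq _ (mates_switch h_sym h_irr hu yx hxy huxy) x.
have [uK _] := hu; rewrite switchL ?(mates_neq h_irr x hu) //.
by move/eqP; rewrite (negPf yux).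
Qed.

(** Sum over all [x], [y] the four adjacencies between the pairs [x], [u x] and [y], [u y]: every
    edge is counted eight times. Each summand is at most 2, and at most 1 for two different root
    edges, which accounts for [#|R| * (#|R| - 2)] choices of [x], [y]. *)
Lemma unique_mates_card (T : finType) (h : rel T) (u : T -> T) (R : {set T}) :
  symmetric h -> irreflexive h -> mates h u -> (forall s, mates h s -> s =1 u) ->
  (forall x, x \in R -> u x \in R) ->
  (forall a b, a \in R -> b \in R -> b != a -> b != u a ->
     ~~ (h a b && h a (u b))) ->
  8 * #|edges h| + #|R| * (#|R| - 2) <= 2 * #|T| ^ 2.
Proof.
move=> h_sym h_irr hu uniq uR blockR; have [uK huu] := hu.
have uinj := inv_inj uK.
pose c x y := [&& x \in R, y \in R, y != x & y != u x].
have block x y : h x y + h x (u y) + (h (u x) y + h (u x) (u y)) + c x y <= 2.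
  have [->|yx] := eqVneq y x.
    by rewrite /c eqxx !andbF !h_irr; do 2 case: (h _ _).
  have [->|yux] := eqVneq y (u x).
    by rewrite /c eqxx !andbF uK !h_irr; do 2 case: (h _ _).
  have B1 := unique_mates_block h_sym h_irr hu uniq yx yux.
  have B2 : ~~ (h x (u y) && h (u x) y).
    rewrite -{2}(uK y); apply: (unique_mates_block h_sym h_irr hu uniq).
      by rewrite (can2_eq uK uK).
    by rewrite (inj_eq uinj).
  rewrite /c yx yux !andbT; have [xR|_] := boolP (x \in R); last first.
    by move: B1 B2; do 4 case: (h _ _).
  have [yR|_] := boolP (y \in R); last first.
    by move: B1 B2; do 4 case: (h _ _).
  have B3 := blockR x y xR yR yx yux.
  have B4 : ~~ (h (u x) y && h (u x) (u y)).
    by apply: blockR; rewrite ?uR ?uK.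
  have B5 : ~~ (h x y && h (u x) y).
    rewrite h_sym [h (u x) _]h_sym; apply: blockR => //; first by rewrite eq_sym.
    by rewrite -(can2_eq uK uK) eq_sym.
  have B6 : ~~ (h x (u y) && h (u x) (u y)).
    rewrite h_sym [h (u x) _]h_sym; apply: blockR; rewrite ?uR //.
      by rewrite eq_sym (can2_eq uK uK).
    by rewrite uK eq_sym.
  (* [B1] to [B6] exclude all six pairs among the four possible edges. *)
  by move: B1 B2 B3 B4 B5 B6; do 4 case: (h _ _).
have ubij : {on predT, bijective u} by apply: onW_bij; exists u.
pose s0 := \sum_x \sum_y h x y.
have s1 : \sum_x \sum_y h x (u y) = s0.
  by apply: eq_bigr => x _; rewrite [RHS](reindex u).
have s2 : \sum_x \sum_y h (u x) y = s0 by rewrite [RHS](reindex u).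
have s3 : \sum_x \sum_y h (u x) (u y) = s0.
  by rewrite -s1 [RHS](reindex u).
have sc : \sum_x \sum_y c x y = #|R| * (#|R| - 2).
  rewrite -sum_nat_const [RHS]big_mkcond /=; apply: eq_bigr => x _.
  case: ifP => xR; last by rewrite big1 // => y _; rewrite /c xR.
  transitivity #|R :\ x :\ u x|.
    rewrite -sum1_card [RHS]big_mkcond /=; apply: eq_bigr => y _.
    by rewrite !inE /c xR; case: (y \in R); case: eqP; case: eqP.
  have := cardsD1 x R; have := cardsD1 (u x) (R :\ x).
  by rewrite !inE (mates_neq h_irr x hu) uR // xR; lia.
have : \sum_x \sum_y (h x y + h x (u y) + (h (u x) y + h (u x) (u y)) + c x y)
       <= \sum_(x : T) \sum_(y : T) 2.
  by apply: leq_sum => x _; apply: leq_sum => y _; apply: block.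
under eq_bigr do rewrite !big_split /=.
rewrite !big_split /= s1 s2 s3 sc !sum_nat_const.
have := card_edges_le h_sym h_irr; rewrite -/s0.
rewrite [2 * #|T| ^ 2]mulnC -mulnn -[#|T| * #|T| * 2]mulnA.
move=> le_s0; apply: leq_trans; rewrite leq_add2r.
have quadruple p q : 2 * p <= q -> 8 * p <= q + q + (q + q) by lia.
exact: quadruple.
Qed.

(** With m edges and c root edges, the cactus gives gf <= m - 3n + c + 1, and the edge count gives
    Af >= m - n^2 + c(c-1)/2. *)
Lemma global_forcing_number_upper (T : finType) (e : rel T) (n : nat) :
  symmetric e -> irreflexive e -> (forall x y, connect e x y) ->
  (exists M, perfect_matching e M) -> #|T| = 2 * n ->
  global_forcing_number e + 3 * n <= max_anti_forcing_number e + n ^ 2 + 2.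
Proof.
move=> e_sym e_irr e_conn [M0 pM0] cT.
have [u eu _] := perfect_matchingP e_sym e_irr pM0.
have [A /(anti_forcing_setP e_sym e_irr _ eu)[sA uniq] cA] :=
  anti_forcing_number_attained e_sym e_irr eu.
have := anti_forcing_number_le_max e_sym e_irr eu; rewrite -cA => leA.
have [f [F [k [R [cfF kE uR blockR]]]]] := cactus_forest e_sym e_irr eu.
have [F' [sF' sepF' leF']] := cactus_span e_sym e_irr e_conn cfF.
have gfF : global_forcing_set e (edges e :\: F').
  apply/global_forcing_setP => //; split; first exact: subsetDl.
  move=> s t es et H; apply: sepF' => // x /H.
  have [_ ess] := es; have [_ ett] := et.
  by rewrite !in_setD !in_setC !mem_edges // ess ett !andbT.
have := global_forcing_number_le gfF; rewrite cardsDS // => leS.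
have sAe : A \subset edges e by apply: subset_trans sA (subsetDl _ _).
have hu : mates (delete_edges e A) u.
  apply/mates_delete_edges; split=> // x; apply: contraTN isT => /(subsetP sA).
  by rewrite inE mem_mate_edges ?eqxx //; case: eu.
have := @unique_mates_card _ (delete_edges e A) u R
  (delete_edges_sym e_sym A) (delete_edges_irr e_irr A) hu.
rewrite edges_delete cardsDS //.
have uniq' s : mates (delete_edges e A) s -> s =1 u.
  by case/mates_delete_edges; apply: uniq.
have blockR' a b : a \in R -> b \in R -> b != a -> b != u a ->
    ~~ (delete_edges e A a b && delete_edges e A a (u b)).
  move=> aR bR ba bua; apply: contra (blockR a b aR bR ba bua).
  by case/andP => /andP[-> _] /andP[-> _].
move=> /(_ uniq' uR blockR').
have := subset_leq_card sF'; have := subset_leq_card sAe.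
rewrite cT => leAe leFe; move: leA leS leF' kE leAe leFe; rewrite cT.
set m := #|edges e|; move: #|F'| #|A| #|R| m => F0 A0 r m.
move=> leA leS leF' kE leAe leFe main.
have [c rE] : exists c, r = 2 * c by exists (3 * n - k); lia.
rewrite rE in main kE.
have {}main : 2 * (m - A0) + c * (c - 1) <= 2 * n ^ 2 by nia.
(* This is (c - 1)(c - 2) >= 0, which makes the bound n^2 - 3n + 2 independent of [c]. *)
have : 2 * c <= c * (c - 1) + 2 by case: c {main rE kE} => [|[|c]]; nia.
by lia.
Qed.

(** * Peeling a two-coloured graph *)

Section Peeling.

Variables (T : finType) (e : rel T).
Hypotheses (e_sym : symmetric e) (e_irr : irreflexive e).
Variables (u : T -> T) (c : T -> bool) (S : {set {set T}}).
Hypotheses (eu : mates e u) (cu : forall x, c (u x) = ~~ c x).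
Hypothesis (sepS : separates e S).

Let uK : involutive u. Proof. by case: eu. Qed.

Lemma peeling_vertex (U : {set T}) (x0 : T) :
  (forall x, x \in U -> u x \in U) -> x0 \in U ->
  exists2 x, (x \in U) && ~~ c x &
    #|[set y in U | [&& c y, e x y & [set x; y] \notin S]]| <= 1.
Proof.
move=> uU x0U.
pose N x := [set y in U | [&& c y, e x y & [set x; y] \notin S]].
case: (boolP [exists x in U, ~~ c x && (#|N x| <= 1)]) => [|].
  by case/exists_inP => x xU /andP[cx Nx]; exists x; rewrite ?xU.
rewrite negb_exists => /forallP none; exfalso.
have N2 x : x \in U -> ~~ c x -> 1 < #|N x|.
  by move=> xU cx; have := none x; rewrite xU cx /= -ltnNge.
(* Descent on the number of edges of [s] in [S]. Each edge of [s] joins the two colours and is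
   counted at its uncoloured end. *)
pose nS s := #|[set x | ~~ c x & [set x; s x] \in S]|.
suff noS m s : nS s < m -> mates e s -> (forall x, c (s x) = ~~ c x) ->
    (forall x, x \notin U -> s x = u x) -> False.
  exact: (noS _ u (ltnSn _) eu cu).
elim: m s => // m IH s ltm es cs sU; have [sK ess] := es.
have sUU x : x \in U -> s x \in U.
  move=> xU; apply: contraTT (xU) => sxU; have := sU _ sxU; rewrite sK => ->.
  by apply: contra sxU => /uU; rewrite uK.
pose g x := odflt x [pick y in N x | y != s x].
have gP x : x \in U -> ~~ c x -> (g x \in N x) && (g x != s x).
  move=> xU cx; rewrite /g; case: pickP => //= no; have := N2 x xU cx.
  rewrite (cardsD1 (s x)) (_ : N x :\ s x = set0) ?cards0 ?addn0.
    by case: (_ \in _).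
  by apply/setP => y; have := no y; rewrite !inE andbC.
pose phi x := s (g x).
pose XU := [set x in U | ~~ c x].
have phiX x : x \in XU -> phi x \in XU.
  rewrite !inE => /andP[xU cx]; have /andP[] := gP x xU cx.
  by rewrite inE /phi cs => /and4P[gU -> _ _] _; rewrite sUU.
pose closed := fun Z : {set T} => (Z != set0) && [forall x in Z, phi x \in Z].
have XUclosed : closed XU.
  apply/andP; split; last by apply/forall_inP.
  apply/set0Pn; have [cx0|cx0] := boolP (c x0); last by exists x0; rewrite inE x0U.
  by exists (u x0); rewrite inE uU // cu cx0.
(* On a minimal nonempty set closed under [phi], the map [phi] is a permutation; this replaces
   following the walk until it closes up. *)
have [Z /minsetP[/andP[Z0 /forall_inP Zcl] Zmin] ZXU] := minset_exists XUclosed.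
have phiZ : phi @: Z = Z.
  apply: Zmin; last by apply/subsetP => _ /imsetP[x xZ ->]; apply: Zcl.
  apply/andP; split.
    by have [z zZ] := set0Pn _ Z0; apply/set0Pn; exists (phi z); rewrite imset_f.
  by apply/forall_inP => _ /imsetP[x xZ ->]; rewrite imset_f // Zcl.
have phi_inj : {in Z &, injective phi} by apply/imset_injP; rewrite phiZ.
have ZU x : x \in Z -> (x \in U) && ~~ c x.
  by move/(subsetP ZXU); rewrite inE.
(* [p] acts as [phi] on [Z] and fixes the rest. Applying [p] before [s] at uncoloured vertices, and
   its inverse after [s] at coloured ones, gives an involution [s'] that sends each [x] in [Z] to
   [g x]. *)
pose q x := if x \in Z then phi x else x.
have q_inj : injective q.
  move=> x y; rewrite /q.
  have [xZ|xZ] := boolP (x \in Z); have [yZ|yZ] := boolP (y \in Z) => // E.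
  - exact: phi_inj.
  - by rewrite -E Zcl in yZ.
  - by rewrite E Zcl in xZ.
pose p := perm q_inj.
have cp x : c (p x) = c x.
  rewrite permE /q; case: ifP => // xZ.
  by have /andP[_ /negPf->] := ZU _ xZ; have /andP[_ /negPf->] := ZU _ (Zcl _ xZ).
have cpV x : c ((p^-1)%g x) = c x by rewrite -cp permKV.
pose s' x := if c x then (p^-1)%g (s x) else s (p x).
have s'Y x : c x -> s' x = (p^-1)%g (s x) by rewrite /s' => ->.
have s'X x : ~~ c x -> s' x = s (p x) by rewrite /s' => /negPf ->.
have cs' x : c (s' x) = ~~ c x.
  have [cx|cx] := boolP (c x); first by rewrite s'Y // cpV cs cx.
  by rewrite s'X // cs cp.
have s'K : involutive s'.
  move=> x; have [cx|cx] := boolP (c x).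
    by rewrite s'X ?cs' ?cx // s'Y // permKV sK.
  by rewrite [in LHS]s'Y ?cs' // s'X // sK permK.
have s'Z x : x \in Z -> s' x = g x.
  move=> xZ; have /andP[_ cx] := ZU _ xZ.
  by rewrite s'X // permE /q xZ /phi sK.
have s'nZ x : ~~ c x -> x \notin Z -> s' x = s x.
  by move=> cx /negPf xZ; rewrite s'X // permE /q xZ.
have NZ x : x \in Z -> [/\ e x (g x), [set x; g x] \notin S & g x != s x].
  move=> /ZU/andP[xU cx]; have /andP[] := gP x xU cx.
  by rewrite inE => /and4P[].
have es' : mates e s'.
  split=> // x.
  have H z : ~~ c z -> e z (s' z).
    have [zZ _|zZ cz] := boolP (z \in Z); first by rewrite s'Z //; case: (NZ z zZ).
    by rewrite s'nZ.
  have [cx|/H//] := boolP (c x).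
  by have := H (s' x); rewrite s'K e_sym cs' cx; apply.
have s'U x : x \notin U -> s' x = u x.
  have XH z : ~~ c z -> z \notin U -> s' z = u z.
    move=> cz zU; rewrite s'nZ // ?sU //.
    by apply: contra zU => /ZU/andP[].
  move=> xU; have [cx|cx] := boolP (c x); last exact: XH.
  apply: (inv_inj s'K); rewrite s'K.
  by rewrite XH ?uK ?cu ?cx //; apply: contra xU => /uU; rewrite uK.
have sub : [set x | ~~ c x & [set x; s' x] \in S]
    \subset [set x | ~~ c x & [set x; s x] \in S] :\: Z.
  apply/subsetP => x; rewrite !inE => /andP[cx xS].
  have xZ : x \notin Z.
    by apply: contraL xS => xZ; rewrite s'Z //; case: (NZ x xZ).
  by rewrite xZ cx -(s'nZ x).
(* The edges of [s'] at [Z] avoid [S], so an edge of [s] at [Z] lying in [S] would make [nS s']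
   smaller than [nS s]. *)
have ZS z : z \in Z -> [set z; s z] \notin S.
  move=> zZ; apply/negP => zS; apply: (IH s') => //.
  have := subset_leq_card sub; rewrite -/(nS s') => le1; apply: leq_ltn_trans le1 _.
  rewrite ltnS in ltm; apply: leq_trans ltm; apply: proper_card.
  apply/properP; split; first exact: subsetDl.
  have /andP[_ cz] := ZU _ zZ.
  by exists z; rewrite !inE ?zZ // cz.
(* Now [s'] and [s] differ only outside [S], so separation makes them equal, although [g z] is not
   [s z]. *)
have [z zZ] := set0Pn _ Z0; have [_ _ /eqP[]] := NZ z zZ.
rewrite -s'Z //; apply: (sepS es' es) => x nss.
have differ w : ~~ c w -> s' w != s w ->
    [set w; s' w] \notin S /\ [set w; s w] \notin S.
  move=> cw; have [wZ|wZ] := boolP (w \in Z); last by rewrite s'nZ ?eqxx.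
  by rewrite s'Z // => _; rewrite ZS //; have [] := NZ w wZ.
have [cx|cx] := boolP (c x); last exact: differ.
have [] := differ (s' x).
- by rewrite cs' cx.
- by rewrite s'K; apply: contraNneq nss => {2}->; rewrite sK.
rewrite s'K setUC => -> _; split=> //.
have [] := differ (s x); rewrite ?cs ?cx // sK 1?[[set s x; x]]setUC //.
by apply: contraNneq nss => {1}<-; rewrite s'K.
Qed.

Definition cut : {set {set T}} :=
  [set f : {set T} | [exists x in f, exists y in f, c x != c y]].

Lemma mem_cut x y : ([set x; y] \in cut) = (c x != c y).
Proof.
rewrite inE; apply/exists_inP/idP => [[a + /exists_inP[b]]|cxy].
  by rewrite !inE => /orP[]/eqP-> /orP[]/eqP->; rewrite ?eqxx // eq_sym.
by exists x; rewrite ?set21 //; apply/exists_inP; exists y; rewrite ?set22.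
Qed.

(** Take [x] from [peeling_vertex] and delete its edges to coloured vertices of [U] other than
    [u x]. This fixes the mate of [x], and the argument repeats without [x] and [u x]. Edges of [S]
    charged at [x] do not lie inside the smaller set, so none is charged twice. *)
Lemma peeling (U : {set T}) : (forall x, x \in U -> u x \in U) ->
  exists A : {set {set T}}, [/\ A \subset edges e :\: mate_edges u,
    #|A| <= #|[set f in S :&: cut | f \subset U]|
    & forall s, mates e s -> (forall x, c (s x) = ~~ c x) ->
        (forall x, x \notin U -> s x = u x) ->
        (forall x, [set x; s x] \notin A) -> s =1 u].
Proof.
have [m] := ubnP #|U|; elim: m U => // m IH U ltm uU.
have [U0|[x0 x0U]] := set_0Vmem U.
  exists set0; split; rewrite ?sub0set ?cards0 // => s _ _ sU _ x.
  by rewrite sU // U0 inE.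
have [x /andP[xU cx] Nx] := peeling_vertex uU x0U.
have uxU := uU _ xU; have ux : u x != x by apply: mates_neq eu.
set U' := U :\ x :\ u x.
have ltU' : #|U'| < m.
  have := cardsD1 x U; have := cardsD1 (u x) (U :\ x).
  by rewrite !inE ux uxU xU /= -/U' => E1 E2; move: ltm; rewrite E2 E1; clear; lia.
have uU' y : y \in U' -> u y \in U'.
  rewrite !inE => /and3P[yux yx yU].
  by rewrite (inj_eq (inv_inj uK)) yx (can2_eq uK uK) yux uU.
have [A' [sA' cA' uniqA']] := IH U' ltU' uU'.
pose N := [set y in U | c y && e x y].
pose B := [set [set x; y] | y in N :\ u x].
have [_ ee] := eu.
have set2_inj : injective (fun y => [set x; y]).
  move=> y z /= /setP E; have := E y; have := E z; rewrite !inE !eqxx !orbT.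
  move=> /orP[/eqP->|/eqP//].
  by rewrite orbb => /esym/eqP.
(* At most one of the edges at [x] lies outside [S], and the kept edge to [u x] makes up for it. *)
have cB : #|B| <= #|[set y in N | [set x; y] \in S]|.
  rewrite card_imset //; have := cardsD1 (u x) N.
  rewrite inE uxU cu cx ee /= => E.
  have := cardsID [set y | [set x; y] \in S] N.
  have -> : N :&: [set y | [set x; y] \in S] = [set y in N | [set x; y] \in S].
    by apply/setP => y; rewrite !inE.
  have : #|N :\: [set y | [set x; y] \in S]| <= 1.
    apply: leq_trans Nx; apply: subset_leq_card; apply/subsetP => y.
    by rewrite !inE => /and4P[-> -> -> ->].
  have arith i j k : i <= 1 -> j + i = 1 + k -> k <= j by clear; lia.
  by rewrite E; apply: arith.
exists (A' :|: B); split.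
- rewrite subUset sA'; apply/subsetP => _ /imsetP[y yN ->].
  move: yN; rewrite !inE => /and4P[yux yU cy exy].
  by rewrite mem_mate_edges // yux mem_edges.
- apply: leq_trans (leq_card_setU _ _) _.
  apply: leq_trans (leq_add cA' cB) _.
  rewrite -(card_imset _ set2_inj).
  set F1 := [set f in S :&: cut | f \subset U'].
  set F2 := (fun y => [set x; y]) @: _.
  have F12 : F1 :&: F2 = set0.
    apply/setP => f; rewrite in_set0 in_setI; apply/andP => -[].
    rewrite inE => /andP[_ fU'] /imsetP[y _ fE].
    by move: fU'; rewrite fE subUset !sub1set !inE eqxx andbF.
  have := cardsU F1 F2; rewrite F12 cards0 subn0 => <-.
  apply: subset_leq_card; rewrite subUset; apply/andP; split.
    apply/subsetP => f; rewrite !inE => /andP[-> /subset_trans]; apply.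
    by apply/subsetP => y; rewrite !inE => /and3P[].
  apply/subsetP => _ /imsetP[y yN ->]; rewrite !inE in yN.
  have /andP[/and3P[yU cy exy] yS] := yN.
  by rewrite in_set in_setI subUset !sub1set xU yU yS mem_cut cy (negPf cx).
move=> s es cs sU sA; have [sK ess] := es.
have sxU : s x \in U.
  apply: contraTT (xU) => sxU; have := sU _ sxU; rewrite sK => ->.
  by apply: contra sxU => /uU; rewrite uK.
have sx : s x = u x.
  apply/eqP; apply: contraNT (sA x) => nsx; rewrite in_setU; apply/orP; right.
  by apply: imset_f; rewrite !inE nsx sxU cs cx ess.
apply: uniqA' => // y; last by have := sA y; rewrite in_setU => /norP[].
have [->//|yx] := eqVneq y x.
have [->|yux] := eqVneq y (u x); first by rewrite -sx sK sx uK.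
by rewrite !inE yx yux /=; apply: sU.
Qed.

(** Deleting all edges inside the coloured class leaves only matchings that cross the colouring, and
    peeling then reduces these to [u]. The nonedges in [D] are missing among the ['C(n, 2)] pairs of
    that class, and the members of [B], being off the cut, are not charged by the peeling. *)
Lemma anti_forcing_number_coloring (n : nat) (D B : {set {set T}}) :
  #|T| = 2 * n -> D :&: edges e = set0 ->
  (forall f, f \in D -> #|f| = 2 /\ f \subset [set x | c x]) ->
  B \subset S -> B :&: cut = set0 ->
  anti_forcing_number e (mate_edges u) + #|D| + #|B| <= #|S| + 'C(n, 2).
Proof.
move=> cT De DY BS Bcut.
pose Y := [set x | c x].
have uY : u @: Y = ~: Y.
  apply/setP => x; rewrite !inE; apply/imsetP/idP => [[y + ->]|cx].
    by rewrite inE cu => ->.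
  by exists (u x); rewrite ?inE ?cu ?uK.
have cY : #|Y| = #|~: Y| by rewrite -uY card_imset //; apply: inv_inj.
have cYn : #|Y| = n by have := cardsC Y; rewrite -cY cT; clear; lia.
have [|A0 [sA0 cA0 uniqA0]] := @peeling setT; first by move=> x; rewrite !inE.
pose YY := [set f in edges e | f \subset Y].
have hA : anti_forcing_set e (mate_edges u) (YY :|: A0).
  apply/anti_forcing_setP => //; split.
    rewrite subUset sA0 andbT; apply/subsetP => f; rewrite !inE => /andP[fe fY].
    rewrite fe andbT; have /edgesP[x [y [exy fE]]] := fe.
    rewrite fE mem_mate_edges //; apply/eqP => yE; move: fY.
    by rewrite fE yE subUset !sub1set !inE cu andbN.
  move=> s es sA; have [sK ess] := es.
  have cs1 x : c x -> ~~ c (s x).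
    move=> cx; have := sA x; rewrite in_setU => /norP[+ _].
    by rewrite !inE mem_edges // ess subUset !sub1set !inE cx.
  (* The classes have equal size: if coloured vertices have uncoloured mates, the converse holds
     too. *)
  have sY : s @: Y = ~: Y.
    apply/eqP; rewrite eqEcard card_imset -?cY ?leqnn ?andbT; last exact: inv_inj.
    by apply/subsetP => _ /imsetP[x + ->]; rewrite !inE; apply: cs1.
  apply: uniqA0 => // [x|x|x]; last by have := sA x; rewrite in_setU => /norP[].
    have [cx|cx] := boolP (c x); first by rewrite (negPf (cs1 x cx)).
    have : x \in s @: Y by rewrite sY !inE.
    by case/imsetP => y; rewrite inE => cy ->; rewrite sK cy.
  by rewrite inE.
have := anti_forcing_number_le e_sym e_irr eu hA.
have := leq_card_setU YY A0.
have : #|A0| + #|B| <= #|S|.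
  apply: (@leq_trans (#|S :&: cut| + #|S :\: cut|)); last by rewrite cardsID.
  apply: leq_add.
    apply: leq_trans cA0 _; apply: subset_leq_card; apply/subsetP => f.
    by rewrite inE => /andP[].
  apply: subset_leq_card; apply/subsetP => f fB; rewrite in_setD (subsetP BS) //.
  rewrite andbT; apply/negP => fc.
  have : f \in B :&: cut by rewrite in_setI fB.
  by rewrite Bcut inE.
have : #|YY| + #|D| <= 'C(n, 2).
  rewrite -cYn -cards_draws.
  have YD : YY :&: D = set0.
    apply/setP => f; rewrite in_set0; apply/negP.
    rewrite in_setI in_set => /andP[/andP[fe _] fD].
    have : f \in D :&: edges e by rewrite in_setI fD.
    by rewrite De inE.
  have := cardsU YY D; rewrite YD cards0 subn0 => <-.
  apply: subset_leq_card; rewrite subUset; apply/andP; split.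
    apply/subsetP => f; rewrite !inE => /andP[/edgesP[x [y [exy ->]]] sY].
    have xy : x != y by apply: contraTneq exy => ->; rewrite e_irr.
    by rewrite sY cards2 xy.
  by apply/subsetP => f /DY[cf fY]; rewrite inE fY cf eqxx.
have arith y d a b w f s k : y + d <= k -> a + b <= s -> w <= y + a -> f <= w ->
    f + d + b <= s + k by clear; lia.
exact: arith.
Qed.

End Peeling.

(** * Finding one or two gains for the lower bound *)

Section LowerBound.

Variables (T : finType) (e : rel T).
Hypotheses (e_sym : symmetric e) (e_irr : irreflexive e).
Variables (u : T -> T) (S : {set {set T}}) (n : nat).
Hypotheses (eu : mates e u) (sS : S \subset edges e) (sepS : separates e S).
Hypothesis (card_T : #|T| = 2 * n).

Let uK : involutive u. Proof. by case: eu. Qed.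
Let ux x : u x != x. Proof. exact: mates_neq eu. Qed.

Lemma coloring_exists (Y : {set T}) : (forall x, x \in Y -> u x \notin Y) ->
  exists2 c : T -> bool, forall x, c (u x) = ~~ c x & forall x, x \in Y -> c x.
Proof.
(* On an edge of [u] that misses [Y], the end of smaller rank is coloured. *)
move=> uY; pose c x := (x \in Y) || (u x \notin Y) && (enum_rank x < enum_rank (u x)).
exists c => x; last by rewrite /c => ->.
rewrite /c uK; have [xY|xY] := boolP (x \in Y); first by rewrite (negPf (uY x xY)).
have [//|uxY /=] := boolP (u x \in Y).
rewrite -leqNgt ltn_neqAle andbC; case: leqP => //= _.
by rewrite (inj_eq val_inj) (inj_eq enum_rank_inj) ux.
Qed.

(** The form in which gains are collected: a partial transversal [Y] extends to a colouring, so only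
    the vertices of the gains have to be placed. *)
Lemma anti_forcing_number_transversal (Y : {set T}) (D B : {set {set T}}) :
  (forall x, x \in Y -> u x \notin Y) -> D :&: edges e = set0 ->
  (forall f, f \in D -> #|f| = 2 /\ f \subset Y) ->
  B \subset S -> (forall f, f \in B -> f \subset Y \/ f \subset u @: Y) ->
  anti_forcing_number e (mate_edges u) + #|D| + #|B| <= #|S| + 'C(n, 2).
Proof.
move=> uY De DY BS BY; have [c cu cY] := coloring_exists uY.
apply: (anti_forcing_number_coloring e_sym e_irr eu cu sepS card_T De) => //.
  move=> f /DY[cf fY]; split=> //; apply/subsetP => x /(subsetP fY) /cY.
  by rewrite inE.
apply/setP => f; rewrite in_set0; apply/negP; rewrite in_setI inE.
move=> /andP[/BY fY /exists_inP[x xf /exists_inP[y yf]]].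
case: fY => /subsetP fY; first by rewrite !cY ?fY.
have /imsetP[x' x'Y ->] := fY x xf; have /imsetP[y' y'Y ->] := fY y yf.
by rewrite !cu !cY.
Qed.

(** Otherwise [t] and its switch on this 4-cycle would be different perfect matchings with the same
    trace on [S]. *)
Lemma four_cycle_forcing (t : T -> T) (x y : T) : mates e t ->
  y != x -> y != t x -> e x y -> e (t x) (t y) ->
  [|| [set x; t x] \in S, [set y; t y] \in S, [set x; y] \in S
    | [set t x; t y] \in S].
Proof.
move=> et yx ytx exy etxy; have [tK _] := et; have tx := mates_neq e_irr x et.
apply: contraT; rewrite !negb_or => /and4P[S1 S2 S3 S4].
suff : switch t x y =1 t by move/(_ x)/eqP; rewrite switchL // (negPf ytx).
have es := mates_switch e_sym e_irr et yx exy etxy; have [sK _] := es.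
have swx : switch t x y x = y by rewrite switchL.
have swtx : switch t x y (t x) = t y.
  have ty : t y != y by apply: mates_neq et.
  by rewrite /switch tpermL tpermD ?(inj_eq (inv_inj tK)) 1?eq_sym.
apply: sepS => // z; have [->|zx] := eqVneq z x; first by rewrite swx S1 S3.
have [->|zy] := eqVneq z y.
  by rewrite switchR // S2 setUC S3.
have [->|ztx] := eqVneq z (t x); first by rewrite swtx tK S4 setUC S1.
have [->|zty] := eqVneq z (t y).
  have -> : switch t x y (t y) = t x by rewrite -swtx sK.
  by rewrite tK setUC S4 setUC S2.
by rewrite switch_id // eqxx.
Qed.

(** Expresses that [a] and [b] lie on different edges of [u]. *)
Definition far (a b : T) := (b != a) && (b != u a).

Lemma farC a b : far a b = far b a.
Proof. by rewrite /far eq_sym [b == u a]eq_sym (can2_eq uK uK). Qed.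

Lemma far_mater a b : far a (u b) = far a b.
Proof. by rewrite /far (can2_eq uK uK) (inj_eq (inv_inj uK)) andbC. Qed.

Lemma far_matel a b : far (u a) b = far a b.
Proof. by rewrite farC far_mater farC. Qed.

Lemma far_neq a b : far a b ->
  [/\ (a == b) = false, (b == a) = false, (u a == b) = false & (b == u a) = false].
Proof.
by move=> /andP[/negPf ba /negPf bua]; rewrite eq_sym [u a == b]eq_sym.
Qed.

Lemma far_notin_mate_edges a b : far a b -> [set a; b] \notin mate_edges u.
Proof. by rewrite mem_mate_edges // => /andP[]. Qed.

(** If all four edges were present, they would form a 4-cycle outside [S] that alternates for the
    matching obtained by switching [u]. *)
Lemma block_nonedge x y : far x y ->
  (forall x' y', x' \in [set x; u x] -> y' \in [set y; u y] -> [set x'; y'] \notin S) ->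
  exists x' y', [/\ x' \in [set x; u x], y' \in [set y; u y] & ~~ e x' y'].
Proof.
move=> fxy nS.
have [yx yux] := andP fxy.
have [exy|?] := boolP (e x y); last by exists x, y; rewrite !inE !eqxx.
have [euxy|?] := boolP (e (u x) y).
  have [exuy|?] := boolP (e x (u y)); last first.
    by exists x, (u y); rewrite !inE !eqxx orbT.
  have [euxuy|?] := boolP (e (u x) (u y)); last first.
    by exists (u x), (u y); rewrite !inE !eqxx !orbT.
  have et := mates_switch e_sym e_irr eu yx exy euxuy.
  have tx : switch u x y x = y by rewrite switchL.
  have tux : switch u x y (u x) = u y.
    by rewrite /switch tpermL tpermD ?(inj_eq (inv_inj uK)) 1?eq_sym.
  have tuy : switch u x y (u y) = u x by rewrite -tux; case: et => ->.
  have uyx : u y != x by rewrite (can2_eq uK uK).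
  have := four_cycle_forcing et uyx; rewrite tx tuy [e y _]e_sym.
  rewrite [[set u y; _]]setUC [[set y; u x]]setUC => /(_ (ux y) exuy euxy).
  by rewrite !(negPf (nS _ _ _ _)) ?inE ?eqxx ?orbT.
by exists (u x), y; rewrite !inE !eqxx !orbT.
Qed.

Lemma fresh_vertex (A : {set T}) : #|A| < 2 * n -> exists x, x \notin A.
Proof.
move=> ltA; have : 0 < #|~: A| by have := cardsC A; rewrite card_T; lia.
by case/card_gt0P => x; rewrite inE => xA; exists x.
Qed.

Lemma edge_notin_mate_edges f : f \in S -> f \notin mate_edges u ->
  exists a b, [/\ f = [set a; b], e a b & far a b].
Proof.
move=> /(subsetP sS) /edgesP[a [b [eab ->]]]; rewrite mem_mate_edges // => nM.
exists a, b; split; rewrite // /far nM andbT.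
by apply: contraTneq eab => ->; rewrite e_irr.
Qed.

Lemma nonedge_pair a b : a != b -> ~~ e a b ->
  [set [set a; b]] :&: edges e = set0.
Proof.
move=> ab neab; apply/setP => f; rewrite !inE; case: eqP => //= ->.
by rewrite mem_edges // (negPf neab).
Qed.

Lemma transversal2 a b : far a b ->
  forall x, x \in [set a; b] -> u x \notin [set a; b].
Proof.
move=> fab x; have [_ _ E1 E2] := far_neq fab; rewrite !inE.
rewrite farC in fab; have [_ _ E3 E4] := far_neq fab.
by move=> /orP[]/eqP->; rewrite (negPf (ux _)) ?E1 ?E2 ?E3 ?E4.
Qed.

Lemma transversal3 a b d : far a b -> far a d -> far b d ->
  forall x, x \in [set a; b; d] -> u x \notin [set a; b; d].
Proof.
move=> fab fad fbd x; rewrite !inE.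
have [_ _ E1 _] := far_neq fab; have [_ _ E2 _] := far_neq fad.
have [_ _ E3 _] := far_neq fbd; rewrite farC in fab; rewrite farC in fad.
rewrite farC in fbd; have [_ _ E4 _] := far_neq fab.
have [_ _ E5 _] := far_neq fad; have [_ _ E6 _] := far_neq fbd.
by rewrite -orbA => /or3P[]/eqP->; rewrite (negPf (ux _)) ?E1 ?E2 ?E3 ?E4 ?E5 ?E6.
Qed.

(** The gain is an edge of [S] outside [u] if there is one; otherwise [block_nonedge] supplies a
    nonedge. *)
Lemma anti_forcing_number_lower : 1 < n ->
  anti_forcing_number e (mate_edges u) + 1 <= #|S| + 'C(n, 2).
Proof.
move=> n_gt1; case: (boolP (S \subset mate_edges u)) => [SM|].
  have [|x _] := @fresh_vertex set0; first by rewrite cards0; lia.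
  have [|y] := @fresh_vertex [set x; u x].
    by rewrite cards2; case: (_ == _); rewrite /=; lia.
  rewrite !inE negb_or => fxy.
  have [|x' [y' [x'x y'y ne]]] := @block_nonedge x y fxy.
    move=> x' y' x'x y'y; apply: contra (@far_notin_mate_edges x' y' _).
      exact: (subsetP SM).
    by move: x'x y'y; rewrite !inE => /orP[]/eqP-> /orP[]/eqP->;
      rewrite ?far_matel ?far_mater.
  have fxy' : far x' y'.
    by move: x'x y'y; rewrite !inE => /orP[]/eqP-> /orP[]/eqP->;
      rewrite ?far_matel ?far_mater.
  have [nxy _ _ _] := far_neq fxy'.
  have := @anti_forcing_number_transversal [set x'; y'] [set [set x'; y']] set0.
  rewrite cards1 cards0 addn0; apply.
  - exact: transversal2.
  - by apply: nonedge_pair; rewrite ?nxy.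
  - by move=> f; rewrite inE => /eqP->; rewrite cards2 nxy.
  - exact: sub0set.
  - by move=> f; rewrite inE.
case/subsetPn => f fS /(edge_notin_mate_edges fS)[a [b [fE eab fab]]].
have := @anti_forcing_number_transversal [set a; b] set0 [set f].
rewrite cards1 cards0 addn0; apply.
- exact: transversal2.
- by rewrite set0I.
- by move=> g; rewrite inE.
- by rewrite sub1set.
- by move=> g; rewrite inE => /eqP->; left; rewrite fE.
Qed.

(** Any two edges of [u] have a nonedge between them. If two gains were impossible, the nonedges
    among three edges of [u] would be pairwise disjoint, and the edges then present would carry an
    alternating 4-cycle outside [S]. *)
Lemma anti_forcing_number_lower2_mate_edges : 2 < n -> S \subset mate_edges u ->
  anti_forcing_number e (mate_edges u) + 2 <= #|S| + 'C(n, 2).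
Proof.
move=> n_gt2 SM.
have nS a b : far a b -> [set a; b] \notin S.
  by move=> fab; apply: contra (far_notin_mate_edges fab); apply: (subsetP SM).
have nonedge x y : far x y ->
    exists x' y', [/\ x' \in [set x; u x], y' \in [set y; u y] & ~~ e x' y'].
  move=> fxy; apply: block_nonedge => // x' y' x'x y'y; apply: nS.
  by move: x'x y'y; rewrite !inE => /orP[]/eqP-> /orP[]/eqP->;
    rewrite ?far_matel ?far_mater.
apply: contraT => no.
(* Two nonedges sharing an end, on three edges of the matching, can be put
   inside a colour class. *)
have cherry a b d : far a b -> far a d -> far b d -> ~~ e a b -> e a d.
  move=> fab fad fbd neab; apply: contraNT no => nead.
  have [ab _ _ _] := far_neq fab; have [ad _ _ _] := far_neq fad.
  have [bd _ _ _] := far_neq fbd.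
  have neq : [set a; b] != [set a; d].
    by apply/eqP => /setP/(_ b); rewrite !inE eqxx orbT bd eq_sym ab.
  have := @anti_forcing_number_transversal [set a; b; d]
    [set [set a; b]; [set a; d]] set0.
  rewrite cards2 neq cards0 addn0; apply.
  - exact: transversal3.
  - by rewrite setIUl !nonedge_pair ?ab ?ad // setU0.
  - move=> f; rewrite !inE => /orP[]/eqP->; rewrite cards2 ?ab ?ad; split=> //.
      by rewrite subUset !sub1set !inE !eqxx ?orbT.
    by rewrite subUset !sub1set !inE !eqxx ?orbT.
  - exact: sub0set.
  - by move=> f; rewrite inE.
have [|p0 _] := @fresh_vertex set0; first by rewrite cards0; lia.
have [|q0] := @fresh_vertex [set p0; u p0].
  by rewrite cards2; case: (_ == _); rewrite /=; lia.
rewrite !inE negb_or => fpq0.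
have [p [q [+ + neq]]] := nonedge _ _ fpq0.
move=> pp0 qq0; have fpq : far p q.
  by move: pp0 qq0; rewrite !inE => /orP[]/eqP-> /orP[]/eqP->;
    rewrite ?far_matel ?far_mater.
have [|r0] := @fresh_vertex ([set p; u p] :|: [set q; u q]).
  apply: leq_ltn_trans (leq_card_setU _ _) _.
  by rewrite !cards2; do 2 case: (_ == _); rewrite /=; lia.
rewrite !inE !negb_or => /andP[fpr0 fqr0].
have [p' [r [+ + ner]]] := nonedge _ _ fpr0.
move=> p'p rr0.
have fpr : far p r.
  by move: rr0; rewrite !inE => /orP[]/eqP->; rewrite ?far_mater.
have fqr : far q r.
  by move: rr0; rewrite !inE => /orP[]/eqP->; rewrite ?far_mater.
have frq : far r q by rewrite farC.
have fqp : far q p by rewrite farC.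
have frp : far r p by rewrite farC.
have farE := (far_matel, far_mater).
(* The nonedge to [r] cannot start at [p], which already has one to [q]; so it starts at [u p]. *)
move: p'p ner; rewrite !inE => /orP[]/eqP->; first by rewrite (cherry p q r).
move=> ner.
have e_pr := cherry p q (u r); rewrite !farE in e_pr.
have {}e_pr := e_pr fpq fpr fqr neq.
have e_upq := cherry (u p) r q; rewrite !farE in e_upq.
have {}e_upq := e_upq fpr fpq frq ner.
have e_upuq := cherry (u p) r (u q); rewrite !farE in e_upuq.
have {}e_upuq := e_upuq fpr fpq frq ner.
have neq' : ~~ e q p by rewrite e_sym.
have ner' : ~~ e r (u p) by rewrite e_sym.
have e_qr := cherry q p r fqp fqr fpr neq'.
have e_qur := cherry q p (u r); rewrite !farE in e_qur.
have {}e_qur := e_qur fqp fqr fpr neq'.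
have e_ruq := cherry r (u p) (u q); rewrite !farE in e_ruq.
have {}e_ruq := e_ruq frp frq fpq ner'.
(* [q] and [r] already have nonedges elsewhere, so the one between their edges of [u] joins [u q]
   and [u r]. *)
have neuqur : ~~ e (u q) (u r).
  have [q' [r' [+ +]]] := nonedge _ _ fqr; rewrite !inE.
  by move=> /orP[]/eqP-> /orP[]/eqP->; rewrite ?e_qr ?e_qur // e_sym e_ruq.
have neuruq : ~~ e (u r) (u q) by rewrite e_sym.
have e_uqp := cherry (u q) (u r) p; rewrite !farE in e_uqp.
have {}e_uqp := e_uqp fqr fqp frp neuqur.
have e_urup := cherry (u r) (u q) (u p); rewrite !farE in e_urup.
have {}e_urup := e_urup frq frp fqp neuruq.
have [qp pq up_q q_up] := far_neq fpq; have [rp pr up_r r_up] := far_neq fpr.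
have [rq qr uq_r r_uq] := far_neq fqr.
have uinj := inv_inj uK.
(* Two switches turn the three edges of [u] into [p] with [u q], [u p] with [u r], and [q] with
   [r]. *)
pose t1 := switch u p (u q).
have et1 : mates e t1.
  apply: mates_switch => //; first by rewrite (can2_eq uK uK) eq_sym up_q.
    by rewrite e_sym.
  by rewrite uK.
have [t1K _] := et1.
have t1up : t1 (u p) = q.
  by rewrite /t1 /switch tpermL uK tpermD ?up_q.
have t1ur : t1 (u r) = r.
  have /andP[] : far (u p) r by rewrite far_matel.
  rewrite uK => r_nup r_np.
  have /andP[] : far (u q) r by rewrite far_matel.
  rewrite uK => r_nuq r_nq.
  by rewrite /t1 switch_id ?uK // ?(inj_eq uinj) // (can2_eq uK uK) // uK.
have t1p : t1 p = u q.
  by rewrite /t1 switchL // (can2_eq uK uK) eq_sym up_q.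
pose t := switch t1 (u p) (u r).
have urup : u r != u p by rewrite (inj_eq uinj) pr.
have et : mates e t.
  by apply: mates_switch; rewrite // ?t1up ?t1ur // e_sym.
have [tK _] := et.
have tup : t (u p) = u r by rewrite /t switchL // (mates_neq e_irr _ et1).
have tp : t p = u q.
  have pup : p != u p by rewrite eq_sym.
  rewrite /t switch_id ?t1p ?t1up ?t1ur // ?qp ?rp //.
  by rewrite -(can2_eq uK uK) up_r.
have tur : t (u r) = u p by rewrite -tup tK.
have urp : u r != p by rewrite (can2_eq uK uK) r_up.
(* The 4-cycle [p], [u q], [u p], [u r] alternates for [t] and contains no edge of [u], hence none
   of [S]. *)
have := four_cycle_forcing et urp; rewrite tp tur (inj_eq uinj) qr [e (u q) _]e_sym.
move=> /(_ isT e_pr e_upuq).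
by rewrite !(negPf (nS _ _ _)) ?farE.
Qed.

(** When [S] has an edge [f] outside [u], this is one gain. The second is another such edge that
    leaves the four vertices [K] of the two edges of [u] at [f], or else a nonedge leaving [K]. *)
Lemma anti_forcing_number_lower2 : 2 < n ->
  anti_forcing_number e (mate_edges u) + 2 <= #|S| + 'C(n, 2).
Proof.
move=> n_gt2; case: (boolP (S \subset mate_edges u)) => [SM|].
  exact: anti_forcing_number_lower2_mate_edges.
case/subsetPn => f fS fM; have [a [b [fE eab fab]]] := edge_notin_mate_edges fS fM.
pose K := [set a; u a] :|: [set b; u b].
have cK : #|K| <= 4.
  apply: leq_trans (leq_card_setU _ _) _.
  by rewrite !cards2; do 2 case: (_ == _).
have KP x : x \notin K -> far a x /\ far b x.
  by rewrite !inE !negb_or => /andP[].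
have uaub_im Y : u a \in Y -> u b \in Y -> f \subset u @: Y.
  move=> uaY ubY; rewrite fE subUset !sub1set; apply/andP; split; apply/imsetP.
    by exists (u a); rewrite ?uK.
  by exists (u b); rewrite ?uK.
case: (boolP [exists g in S :\: mate_edges u, ~~ (g \subset K)]) => [|none].
  case/exists_inP => g; rewrite inE => /andP[gM gS] gK.
  have [d1 [d2 [gE ed fd]]] := edge_notin_mate_edges gS gM.
  have {gE ed fd gK} [c [d [gE fcd dK]]] :
      exists c d, [/\ g = [set c; d], far c d & d \notin K].
    move: gK; rewrite gE subUset !sub1set negb_and => /orP[dK|dK].
      by exists d2, d1; rewrite setUC farC.
    by exists d1, d2.
  have gf : f != g by apply: contraNneq dK => fg; move: (set22 c d);
    rewrite -gE -fg fE !inE => /orP[]/eqP->; rewrite eqxx ?orbT.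
  have [fad fbd] := KP d dK.
  suff [Y [uY fY gY]] : exists Y : {set T}, [/\ forall x, x \in Y -> u x \notin Y,
      f \subset Y & g \subset Y \/ g \subset u @: Y].
    have := @anti_forcing_number_transversal Y set0 [set f; g].
    rewrite cards2 gf cards0 addn0; apply=> //.
    - by rewrite set0I.
    - by move=> h; rewrite inE.
    - by rewrite subUset !sub1set fS gS.
    - by move=> h; rewrite !inE => /orP[]/eqP-> //; left.
  have [cK'|cK'] := boolP (c \in K).
    have [cab|cab] : (c \in [set a; b]) \/ (u c \in [set a; b]).
      move: cK'; rewrite !inE -orbA => /or4P[]/eqP->; rewrite ?uK ?eqxx ?orbT;
        by [left|right].
      exists [set a; b; d]; split; first exact: transversal3.
        by rewrite fE subsetUl.
      by left; rewrite gE subUset !sub1set in_setU cab !inE eqxx orbT.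
    (* Here [c] is the mate of [a] or [b], so [g] is placed in [u @: Y], on the side opposite to
       [f]. *)
    exists [set a; b; u d]; split; first by apply: transversal3; rewrite ?far_mater.
      by rewrite fE subsetUl.
    right; rewrite gE subUset !sub1set; apply/andP; split; apply/imsetP.
      by exists (u c); rewrite ?uK // in_setU cab.
    by exists (u d); rewrite ?uK // !inE eqxx !orbT.
  have [fac fbc] := KP c cK'.
  exists ([set a; b; c] :|: [set d]); split; last first.
  - by left; rewrite gE subUset !sub1set !inE !eqxx !orbT.
  - by rewrite fE -setUA subsetUl.
  move=> x; rewrite !in_setU !in_set1 => xY; apply/negP.
  have tr := transversal3 fab fac fbc.
  have far_d y : y \in [set a; b; c] -> far y d.
    by rewrite !inE -orbA => /or3P[]/eqP->.
  move: xY; rewrite -!in_set1 -!in_setU => xY; move: xY; rewrite in_setU in_set1.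
  case/orP => [xY|/eqP->]; rewrite in_setU in_set1.
    rewrite (negPf (tr x xY)) /= => /eqP uxd.
    by have /andP[_] := far_d x xY; rewrite uxd eqxx.
  rewrite (negPf (ux d)) orbF => /far_d; rewrite far_matel.
  by rewrite /far eqxx.
have SK g : g \in S -> g \notin mate_edges u -> g \subset K.
  move=> gS gM; apply: contraNT none => gK; apply/exists_inP; exists g => //.
  by rewrite inE gM.
have [|z zK] := @fresh_vertex K; first by lia.
have [faz fbz] := KP z zK.
(* No edge of [S] outside [u] leaves [K], so the block between the edges of [u] at [a] and at [z]
   avoids [S]. *)
have [|a' [z' [a'a z'z ne]]] := @block_nonedge a z faz.
  move=> a' z' a'a z'z; apply/negP => /SK; rewrite subUset !sub1set.
  have faz' : far a' z'.
    by move: a'a z'z; rewrite !inE => /orP[]/eqP-> /orP[]/eqP->;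
      rewrite ?far_matel ?far_mater.
  move=> /(_ (far_notin_mate_edges faz'))/andP[_ z'K].
  have [//|] : False \/ z' \notin K; last by rewrite z'K.
  right; move: z'z; rewrite !inE => /orP[]/eqP->; apply/norP; split; rewrite negb_or.
  - by move: faz.
  - by move: fbz.
  - by move: faz; rewrite -far_mater.
  - by move: fbz; rewrite -far_mater.
have faz' : far a z' by move: z'z; rewrite !inE => /orP[]/eqP->; rewrite ?far_mater.
have fbz' : far b z' by move: z'z; rewrite !inE => /orP[]/eqP->; rewrite ?far_mater.
suff [Y [uY fY DY]] : exists Y : {set T}, [/\ forall x, x \in Y -> u x \notin Y,
    f \subset Y \/ f \subset u @: Y & [set a'; z'] \subset Y].
  have az' : a' != z'.
    have : far a' z' by move: a'a; rewrite !inE => /orP[]/eqP->; rewrite ?far_matel.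
    by case/far_neq => ->.
  have := @anti_forcing_number_transversal Y [set [set a'; z']] [set f].
  rewrite !cards1 -addnA; apply=> //.
  - exact: nonedge_pair.
  - by move=> h; rewrite inE => /eqP->; rewrite cards2 az'.
  - by rewrite sub1set.
  - by move=> h; rewrite inE => /eqP->.
move: a'a; rewrite !inE => /orP[]/eqP->.
  exists [set a; b; z']; split; first exact: transversal3.
    by left; rewrite fE subsetUl.
  by rewrite subUset !sub1set !inE !eqxx !orbT.
(* The nonedge starts at [u a], so [Y] takes the mates of [a] and [b], and [f] falls into
   [u @: Y]. *)
exists [set u a; u b; z']; split.
- by apply: transversal3; rewrite ?far_matel ?far_mater.
- by right; apply: uaub_im; rewrite !inE eqxx ?orbT.
- by rewrite subUset !sub1set !inE !eqxx !orbT.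
Qed.

End LowerBound.

(** * Assembling the two bounds *)

Lemma max_anti_forcing_number_upper (T : finType) (e : rel T) (n k : nat) :
  symmetric e -> irreflexive e -> (exists M, perfect_matching e M) ->
  #|T| = 2 * n -> 0 < k <= 2 -> k < n ->
  max_anti_forcing_number e + k <= global_forcing_number e + 'C(n, 2).
Proof.
move=> e_sym e_irr e_pm cT k12 kn.
have [u eu ->] := max_anti_forcing_number_attained e_sym e_irr e_pm.
have [S /(global_forcing_setP e_sym e_irr)[sS sepS] <-] :=
  global_forcing_number_attained e.
(* [k] counts the gains: one is available for n >= 2, two for n >= 3. *)
have [kE|kE] : k = 1 \/ k = 2 by lia.
  by subst k; apply: anti_forcing_number_lower.
by subst k; apply: anti_forcing_number_lower2.
Qed.

Import Order.TTheory GRing.Theory Num.Theory.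
Local Open Scope ring_scope.

Theorem theorem5p2 (T : finType) (e : rel T) (n : nat)
  (e_sym : symmetric e) (e_irr : irreflexive e)
  (e_conn : forall x y : T, connect e x y)
  (e_pm : exists M : {set {set T}}, perfect_matching e M)
  (card_T : #|T| = (2 * n)%N) (card_ge4 : (4 <= 2 * n)%N) :
  let gf : rat := (global_forcing_number e)%:R in
  let Af : rat := (max_anti_forcing_number e)%:R in
  let lower : rat := - (1 / 2 * (n%:R ^+ 2 - n%:R - 2)) in
  let upper : rat := (n%:R - 1) * (n%:R - 2) in
  (lower <= gf - Af <= upper) /\ (gf - Af = lower <-> n = 2%N).
Proof.
move=> gf Af lower upper.
(* By this identity [lower] equals [1 - 'C(n, 2)]. *)
have bin2n : (2 * 'C(n, 2) + n = n ^ 2)%N.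
  have := bin_ffact n 2; rewrite !ffactnS ffactn0 /= (_ : 2`! = 2)%N //.
  by case: n {card_T card_ge4 lower upper} => [|n]; nia.
have bin2q : 2 * 'C(n, 2)%:R + n%:R = n%:R ^+ 2 :> rat.
  by rewrite -natrM -natrD -natrX bin2n.
have le_upper : gf + 3 * n%:R <= Af + n%:R ^+ 2 + 2.
  rewrite -natrX -!natrM -!natrD ler_nat.
  exact: global_forcing_number_upper.
have le_lower k : (0 < k <= 2)%N -> (k < n)%N ->
    Af + k%:R <= gf + 'C(n, 2)%:R.
  by move=> k12 kn; rewrite -!natrD ler_nat; apply: max_anti_forcing_number_upper.
have lower1 := le_lower 1%N isT; have lower2 := le_lower 2%N isT.
have n_gt1 : (1 < n)%N by lia.
have {}lower1 := lower1 n_gt1.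
rewrite /lower /upper; split; first by apply/andP; split; nra.
(* For n >= 3 the second gain makes the lower bound strict; for n = 2 both bounds are 0. *)
split=> [eq_lower|n2].
  apply/eqP; rewrite eqn_leq n_gt1 andbT leqNgt; apply/negP => /lower2 lt_lower.
  by move: eq_lower lt_lower; lra.
by move: le_upper lower1; rewrite /gf /Af n2 (_ : 'C(2, 2) = 1)%N //; lra.
Qed.
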